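(* Let $\mu$ be an $N\times N$ matrix measure satisfying the standing assumptions below, $\{P_n\}$ its orthonormal matrix polynomials with $P_0=M_0^{-1/2}$ and recurrence coefficients $A_n$ (invertible), $B_n$ (self-adjoint), $Q_n(z)=\int\frac{P_n(z)-P_n(x)}{z-x}W(x)d\tau_\mu(x)$, $S(z)=\int\frac{W(x)}{x-z}d\tau_\mu(x)$, $F_k(z)=Q_k(z)+P_k(z)S(z)$. Let $J$ be the Jacobi operator on $\ell^2(\mathbb{C}^N)$ with domain $\mathcal{D}$ (finite sums) given by $JV=e_0\otimes(A_0v_1+B_0v_0)+\sum_{n\ge1}e_n\otimes(A_nv_{n+1}+B_nv_n+A_{n-1}^\ast v_{n-1})$, and let $(J^\ast,\mathcal{D}^\ast)$ be its adjoint. Assume that for every $z\in\mathbb{C}\setminus\mathbb{R}$ and every nonzero $v\in\mathbb{C}^N$, $\sum_{n=0}^\infty\|P_n(z)v\|^2=\infty$. For $z\in\mathbb{C}\setminus\mathbb{R}$ define $G_z$ on $\mathcal{D}$ by $G_zV=\sum_ne_n\otimes\sum_k(G_z)_{n,k}v_k$ with $$(G_z)_{n,k}=\begin{cases}P_n(z)F_k^\ast(z),&n\le k,\\ F_n(z)P_k^\ast(z),&n>k.\end{cases}$$ Then $G_z$ is the resolvent of $J^\ast$: $z$ lies in the resolvent set of $J^\ast$, $G_z$ extends to a bounded operator on $\ell^2(\mathbb{C}^N)$, and $G_z=(J^\ast-z)^{-1}$.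
   Context: Matrix measure $\mu$: $\sigma$-additive map from Borel sets of $\mathbb{R}$ to positive semi-definite $N\times N$ matrices; $\tau_\mu=\mathrm{Tr}\,\mu$; $\mu(B)_{i,j}=\int_BW_{i,j}d\tau_\mu$. Standing assumptions: $\tau_\mu$ has infinite support, all moments $\int x^kW_{i,j}d\tau_\mu$ finite, $W(x)$ positive definite $\tau_\mu$-a.e.; $M_0=\int Wd\tau_\mu$. For a matrix-valued function $F$, $F^\ast(z)=(F(\bar z))^\ast$. Orthonormal polynomials: $\deg P_n=n$, invertible leading coefficient, $\int P_nWP_m^\ast d\tau_\mu=\delta_{n,m}I$, satisfying $zP_n=A_nP_{n+1}+B_nP_n+A_{n-1}^\ast P_{n-1}$ ($n\ge1$), $zP_0=A_0P_1+B_0P_0$. $\ell^2(\mathbb{C}^N)$ is the Hilbert space of square-summable $\mathbb{C}^N$-valued sequences $\sum e_n\otimes v_n$. *)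

(* Defs.v *)
From HB Require Import structures.
From mathcomp Require Import all_boot all_order all_algebra.
From mathcomp Require Import all_classical all_reals all_analysis.
From mathcomp Require Export complex.
Set Implicit Arguments. Unset Strict Implicit. Unset Printing Implicit Defensive.
Import Order.TTheory GRing.Theory Num.Theory.
Import numFieldNormedType.Exports.
Local Open Scope classical_set_scope.
Local Open Scope ring_scope.

Section Defs.
Variable R : realType.
Local Notation C := R[i].

Definition cconj (z : C) : C := conjc z.
Definition cre (x : R) : C := (x%:C)%C.

Definition mxadj m n (A : 'M[C]_(m, n)) : 'M[C]_(n, m) := map_mx cconj A^T.

Definition is_hermitian n (A : 'M[C]_n) := mxadj A = A.
Definition posdef n (A : 'M[C]_n) :=
  is_hermitian A /\ forall v : 'cV[C]_n, v != 0 -> 0 < (mxadj v *m A *m v) 0 0.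

Definition vnorm2 n (v : 'cV[C]_n) : R :=
  \sum_(i < n) ((complex.Re (v i 0)) ^+ 2 + (complex.Im (v i 0)) ^+ 2).

Definition cintegrable (tau : {measure set R -> \bar R}) (f : R -> C) :=
  tau.-integrable setT (fun x => (complex.Re (f x))%:E) /\
  tau.-integrable setT (fun x => (complex.Im (f x))%:E).
Definition cint (tau : {measure set R -> \bar R}) (f : R -> C) : C :=
  ((Rintegral tau setT (fun x => complex.Re (f x))) +i*
   (Rintegral tau setT (fun x => complex.Im (f x))))%C.
Definition mint m n (tau : {measure set R -> \bar R}) (F : R -> 'M[C]_(m, n))
  : 'M[C]_(m, n) := \matrix_(i, j) cint tau (fun x => F x i j).

Definition msupport (tau : {measure set R -> \bar R}) : set R :=
  [set x | forall e : R, 0 < e -> (0 < tau (ball x e))%E].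

(* Standing assumptions on the matrix measure mu(B) = \int_B W dtau, tau = Tr mu *)
Definition matrix_measure_data n (tau : {measure set R -> \bar R})
    (W : R -> 'M[C]_n) :=
  (* W is the density of mu w.r.t. tau = Tr mu, W >= 0 *)
  (\forall x \ae tau, \tr (W x) = 1) /\
  (\forall x \ae tau, is_hermitian (W x) /\
      forall v : 'cV[C]_n, 0 <= (mxadj v *m W x *m v) 0 0) /\
  ~ finite_set (msupport tau) /\
  (forall (k : nat) (i j : 'I_n), cintegrable tau (fun x => cre x ^+ k * W x i j)) /\
  (\forall x \ae tau, posdef (W x)).

Definition mpeval n (p : {poly 'M[C]_n.+1}) (z : C) : 'M[C]_n.+1 := p.[z%:M].

Definition fstar n (F : C -> 'M[C]_n) (z : C) : 'M[C]_n := mxadj (F (cconj z)).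

Section Objects.
Variables (n : nat) (tau : {measure set R -> \bar R}) (W : R -> 'M[C]_n.+1)
          (P : nat -> {poly 'M[C]_n.+1}).

Definition M0 : 'M[C]_n.+1 := mint tau W.

Definition stieltjes (z : C) : 'M[C]_n.+1 :=
  mint tau (fun x => (cre x - z)^-1 *: W x).

Definition Qpol (k : nat) (z : C) : 'M[C]_n.+1 :=
  mint tau (fun x => (z - cre x)^-1 *: ((mpeval (P k) z - mpeval (P k) (cre x)) *m W x)).

Definition Ffun (k : nat) (z : C) : 'M[C]_n.+1 :=
  Qpol k z + mpeval (P k) z *m stieltjes z.

Definition Gz (z : C) (i k : nat) : 'M[C]_n.+1 :=
  if (i <= k)%N then mpeval (P i) z *m fstar (Ffun k) z
  else Ffun i z *m fstar (fun w => mpeval (P k) w) z.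
End Objects.

(* vector sequences: V n = v_n, i.e. V = sum_n e_n (x) v_n *)
Definition l2 n (V : nat -> 'cV[C]_n) := cvgn (series (fun k => vnorm2 (V k))).
Definition l2norm2 n (V : nat -> 'cV[C]_n) : R := limn (series (fun k => vnorm2 (V k))).
Definition supp_below n (M : nat) (V : nat -> 'cV[C]_n) := forall k, (M <= k)%N -> V k = 0.
Definition findom n (V : nat -> 'cV[C]_n) := exists M, supp_below M V.
Definition ipfin n (M : nat) (X Y : nat -> 'cV[C]_n) : 'M[C]_1 :=
  \sum_(k < M) mxadj (Y k) *m X k.

Definition Jac n (A B : nat -> 'M[C]_n) (V : nat -> 'cV[C]_n) : nat -> 'cV[C]_n :=
  fun k => match k with
           | 0 => A 0%N *m V 1%N + B 0%N *m V 0%N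
           | m.+1 => A k *m V k.+1 + B k *m V k + mxadj (A m) *m V m
           end.

(* graph of the adjoint (J^* , D^* ) of (J, D):  U in D^* and J^* U = Y  iff
   U, Y \in l2 and <J V, U> = <V, Y> for all V \in D.  For V supported below M,
   J V is supported below M+1, so both inner products are the finite sums below. *)
Definition Jadj n (A B : nat -> 'M[C]_n) (U Y : nat -> 'cV[C]_n) :=
  l2 U /\ l2 Y /\
  forall (M : nat) (V : nat -> 'cV[C]_n), supp_below M V ->
    ipfin M.+1 (Jac A B V) U = ipfin M.+1 V Y.

End Defs.

(* Main.v *)
(* The kernel G_z is the matrix of multiplication by 1/(x - z) on L^2(W) in the
   orthonormal system P: (G_z)_{n,k} = int P_n(x) W(x) P_k(x)^* / (x - z) dtau.
   Indeed F_n(z) = int P_n W / (x - z), and for n <= k the difference between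
   the integral and P_n(z) F_k^*(z) solves the three-term recurrence in n up to
   n = k with zero initial value; n > k follows by taking adjoints.
   In this form Bessel's inequality and |x - z| >= |Im z| bound G_z by 1/|Im z|
   on finite sequences, and the recurrence x P_n = (J P)_n gives
   (J - z) G_z = 1 entrywise.  Both statements pass to componentwise limits of
   truncations.  Finally, an l^2 solution of (J - z) D = 0 has the form
   D_n = P_n(z) v, so it vanishes by the divergence hypothesis: J^* - z is
   injective and G_z is its two-sided inverse. *)
Require Import Defs.
From HB Require Import structures.
From mathcomp Require Import all_boot all_order all_algebra.
From mathcomp Require Import all_classical all_reals all_analysis.
From mathcomp Require Import complex.
From mathcomp Require Import ring lra.
Set Implicit Arguments. Unset Strict Implicit. Unset Printing Implicit Defensive.
Import Order.TTheory GRing.Theory Num.Theory.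
Import numFieldNormedType.Exports.
Local Open Scope classical_set_scope.
Local Open Scope ring_scope.

(** * Real parts, imaginary parts and conjugates of complex numbers *)

Section ReIm.
Variable R : realType.
Implicit Types a b : R[i].

Lemma complexReD a b : complex.Re (a + b) = complex.Re a + complex.Re b.
Proof. by case: a b => ? ? []. Qed.
Lemma complexImD a b : complex.Im (a + b) = complex.Im a + complex.Im b.
Proof. by case: a b => ? ? []. Qed.
Lemma complexReM a b : complex.Re (a * b) =
  complex.Re a * complex.Re b - complex.Im a * complex.Im b.
Proof. by case: a b => ? ? []. Qed.
Lemma complexImM a b : complex.Im (a * b) =
  complex.Re a * complex.Im b + complex.Im a * complex.Re b.
Proof. by case: a b => ? ? []. Qed.
Lemma complexRe_conj a : complex.Re (cconj a) = complex.Re a.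
Proof. by case: a. Qed.
Lemma complexIm_conj a : complex.Im (cconj a) = - complex.Im a.
Proof. by case: a. Qed.

Lemma complex_eq a b :
  complex.Re a = complex.Re b -> complex.Im a = complex.Im b -> a = b.
Proof. by case: a b => ? ? [] ? ? /= -> ->. Qed.

Lemma cconjD a b : cconj (a + b) = cconj a + cconj b.
Proof. exact: rmorphD. Qed.
Lemma cconjM a b : cconj (a * b) = cconj a * cconj b.
Proof. exact: rmorphM. Qed.
Lemma cconjK a : cconj (cconj a) = a.
Proof. exact: conjcK. Qed.
Lemma cconj_sum I (r : seq I) (p : pred I) (f : I -> R[i]) :
  cconj (\sum_(i <- r | p i) f i) = \sum_(i <- r | p i) cconj (f i).
Proof. exact: rmorph_sum. Qed.


Lemma creX (x : R) k : cre x ^+ k = cre (x ^+ k).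
Proof. by rewrite /cre -rmorphXn. Qed.

Lemma cre_sub_neq0 (z : R[i]) (x : R) : complex.Im z != 0 -> cre x - z != 0.
Proof.
move=> hz; apply: contraNneq hz => /(congr1 (@complex.Im R)).
by case: z => ? ? /=; rewrite sub0r => /eqP; rewrite oppr_eq0.
Qed.

End ReIm.

(** * Conjugate transposes of complex matrices *)

Section Adjoint.
Variable R : realType.

Lemma mxadjE m n (A : 'M[R[i]]_(m, n)) i j : mxadj A i j = cconj (A j i).
Proof. by rewrite !mxE. Qed.
Lemma mxadjD m n (A B : 'M[R[i]]_(m, n)) : mxadj (A + B) = mxadj A + mxadj B.
Proof. by apply/matrixP => i j; rewrite !mxE cconjD. Qed.
Lemma mxadjK m n (A : 'M[R[i]]_(m, n)) : mxadj (mxadj A) = A.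
Proof. by apply/matrixP => i j; rewrite !mxE cconjK. Qed.
Lemma mxadjZ m n a (A : 'M[R[i]]_(m, n)) :
  mxadj (a *: A) = cconj a *: mxadj A.
Proof. by apply/matrixP => i j; rewrite !mxE cconjM. Qed.
Lemma mxadjN m n (A : 'M[R[i]]_(m, n)) : mxadj (- A) = - mxadj A.
Proof. by apply/matrixP => i j; rewrite !mxE /cconj rmorphN. Qed.
Lemma mxadjB m n (A B : 'M[R[i]]_(m, n)) : mxadj (A - B) = mxadj A - mxadj B.
Proof. by rewrite mxadjD mxadjN. Qed.
Lemma mxadjM m n p (A : 'M[R[i]]_(m, n)) (B : 'M[R[i]]_(n, p)) :
  mxadj (A *m B) = mxadj B *m mxadj A.
Proof.
apply/matrixP => i j; rewrite !mxE cconj_sum; apply: eq_bigr => k _.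
by rewrite !mxE cconjM mulrC.
Qed.
Lemma mxadj_sum m n I (r : seq I) (p : pred I) (F : I -> 'M[R[i]]_(m, n)) :
  mxadj (\sum_(i <- r | p i) F i) = \sum_(i <- r | p i) mxadj (F i).
Proof.
apply/matrixP => i j; rewrite !mxE !summxE cconj_sum.
by apply: eq_bigr => k _; rewrite !mxE.
Qed.
Lemma mxadj1 n : mxadj (1%:M : 'M[R[i]]_n) = 1%:M.
Proof.
by apply/matrixP => i j; rewrite !mxE /cconj rmorph_nat eq_sym.
Qed.

Lemma mxadj_mul_vnorm2 n (v : 'cV[R[i]]_n) :
  (mxadj v *m v) 0 0 = cre (vnorm2 v).
Proof.
rewrite mxE /vnorm2 /cre rmorph_sum; apply: eq_bigr => i _.
rewrite !mxE; apply: complex_eq;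
  rewrite ?complexReM ?complexImM ?complexRe_conj ?complexIm_conj /=; ring.
Qed.

End Adjoint.

(** * Real functions of polynomial growth and their integrability *)

Section Tempered.
Variable R : realType.
Implicit Types f g : R -> R.

(* Measurable functions of polynomial growth: a ring of multipliers that keeps
   a density with finite moments integrable. *)
Definition rtempered f := measurable_fun setT f /\
  exists c m, forall x, `|f x| <= c * (1 + x ^+ 2) ^+ m.

Lemma rtemperedD f g : rtempered f -> rtempered g ->
  rtempered (fun x => f x + g x).
Proof.
move=> [mf [c [m hf]]] [mg [d [k hg]]]; split.
  exact: measurable_realfun.measurable_funD.
(* The growth bound at the point 0 forces its constant to be nonnegative. *)
have c0 : 0 <= c by have := hf 0; rewrite expr0n addr0 expr1n mulr1; exact: le_trans.
have d0 : 0 <= d by have := hg 0; rewrite expr0n addr0 expr1n mulr1; exact: le_trans.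
exists (c + d), (m + k)%N => x.
have h1 : 1 <= 1 + x ^+ 2 by rewrite lerDl sqr_ge0.
apply: le_trans (ler_normD _ _) _; rewrite mulrDl lerD //.
  apply: le_trans (hf x) _; rewrite ler_wpM2l // ler_weXn2l // ?leq_addr //.
apply: le_trans (hg x) _; rewrite ler_wpM2l // ler_weXn2l // leq_addl //.
Qed.

Lemma rtemperedM f g : rtempered f -> rtempered g ->
  rtempered (fun x => f x * g x).
Proof.
move=> [mf [c [m hf]]] [mg [d [k hg]]]; split.
  exact: measurable_realfun.measurable_funM.
exists (c * d), (m + k)%N => x.
by rewrite normrM exprD mulrACA ler_pM.
Qed.

Lemma rtempered_bounded f c : measurable_fun setT f ->
  (forall x, `|f x| <= c) -> rtempered f.
Proof. by move=> mf h; split=> //; exists c, 0%N => x; rewrite expr0 mulr1. Qed.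

Lemma rtempered_cst c : rtempered (fun=> c).
Proof. by apply: (@rtempered_bounded (fun=> c) `|c|). Qed.

Lemma rtempered_id : rtempered (fun x => x).
Proof.
split; first exact: measurable_id.
exists 1, 1%N => x; rewrite mul1r expr1 ler_norml; apply/andP; split; nra.
Qed.

Lemma rtemperedN f : rtempered f -> rtempered (fun x => - f x).
Proof.
move=> hf; have := rtemperedM (rtempered_cst (-1)) hf.
by congr rtempered; apply/funext => x; rewrite mulN1r.
Qed.

Lemma rtempered_inv_quad a b : b != 0 ->
  rtempered (fun x => ((x - a) ^+ 2 + b ^+ 2)^-1).
Proof.
move=> b0; have b2 : 0 < b ^+ 2 by rewrite exprn_even_gt0.
have pos x : 0 < (x - a) ^+ 2 + b ^+ 2 by rewrite ltr_wpDl ?sqr_ge0.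
apply: (@rtempered_bounded (fun x => ((x - a) ^+ 2 + b ^+ 2)^-1) (b ^+ 2)^-1).
  apply: measurable_realfun.continuous_measurable_fun => x.
  apply: cvgV; first by rewrite gt_eqF.
  apply: cvgD; last exact: cvg_cst.
  by rewrite !expr2; apply: cvgM; apply: cvgB => //; exact: cvg_cst.
move=> x; rewrite ger0_norm ?invr_ge0 ?(ltW (pos x)) // lef_pV2 ?posrE //.
by rewrite lerDr sqr_ge0.
Qed.

Variable tau : {measure set R -> \bar R}.

Lemma integrable_rtemperedM f w :
  (forall k, tau.-integrable setT (fun x => (x ^+ k * w x)%:E)) ->
  rtempered f -> tau.-integrable setT (fun x => (f x * w x)%:E).
Proof.
move=> hw [mf [c [m hf]]].
(* The extra power [x ^+ k] carries the induction on [j]: one more factor [1 + x ^+ 2] only asks for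
   the exponents [k] and [k + 2]. *)
have hw2 j k : tau.-integrable setT (fun x => ((1 + x ^+ 2) ^+ j * (x ^+ k * w x))%:E).
  elim: j k => [|j IH] k.
    by apply: eq_integrable (hw k) => // x _; rewrite expr0 mul1r.
  have := integrableD measurableT (IH k) (IH k.+2).
  apply: eq_integrable => // x _ /=; rewrite -EFinD; congr EFin.
  by rewrite exprS !exprS; ring.
have := integrableZl measurableT `|c| (hw2 m 0%N).
apply: le_integrable => //.
  apply/measurable_realfun.measurable_EFinP.
  apply: measurable_realfun.measurable_funM => //.
  have := hw 0%N => /integrableP [+ _] => /measurable_realfun.measurable_EFinP.
  by apply: eq_measurable_fun => x _; rewrite expr0 mul1r.
move=> x _ /=; rewrite lee_fin expr0 mul1r !normrM normr_id mulrA.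
rewrite ler_wpM2r // (le_trans (hf x)) // (le_trans (ler_norm _)) //.
by rewrite normrM.
Qed.

End Tempered.

(** * Complex and matrix functions of polynomial growth *)

Section ComplexTempered.
Variable R : realType.
Implicit Types f g : R -> R[i].

Definition ctempered f := rtempered (fun x => complex.Re (f x)) /\
  rtempered (fun x => complex.Im (f x)).

Lemma ctemperedD f g : ctempered f -> ctempered g ->
  ctempered (fun x => f x + g x).
Proof.
move=> [f1 f2] [g1 g2]; split.
- by under eq_fun do rewrite complexReD; exact: rtemperedD.
- by under eq_fun do rewrite complexImD; exact: rtemperedD.
Qed.

Lemma ctemperedM f g : ctempered f -> ctempered g ->
  ctempered (fun x => f x * g x).
Proof.
move=> [f1 f2] [g1 g2]; split.
- under eq_fun do rewrite complexReM.
  by apply: rtemperedD; [|apply: rtemperedN]; exact: rtemperedM.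
- under eq_fun do rewrite complexImM.
  by apply: rtemperedD; exact: rtemperedM.
Qed.

Lemma ctempered_cst a : ctempered (fun=> a).
Proof. by split; exact: rtempered_cst. Qed.

Lemma ctempered_cre : ctempered (@cre R).
Proof. by split; [exact: rtempered_id|exact: rtempered_cst]. Qed.

Lemma ctempered_conj f : ctempered f -> ctempered (fun x => cconj (f x)).
Proof.
move=> [f1 f2]; split.
- by under eq_fun do rewrite complexRe_conj.
- by under eq_fun do rewrite complexIm_conj; exact: rtemperedN.
Qed.

Lemma ctempered_sum I (r : seq I) (F : I -> R -> R[i]) :
  (forall i, ctempered (F i)) -> ctempered (fun x => \sum_(i <- r) F i x).
Proof.
move=> hF; elim: r => [|i r IH].
  by under eq_fun do rewrite big_nil; exact: ctempered_cst.
by under eq_fun do rewrite big_cons; exact: ctemperedD.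
Qed.

(** Multiplying numerator and denominator by the conjugate writes the resolvent factor as a real
    function, bounded when [z] is not real, times an affine one; this is how it is seen to be
    tempered. *)
Lemma inv_cre_sub (z : R[i]) (x : R) :
  (cre x - z)^-1 = cre ((x - complex.Re z) ^+ 2 + complex.Im z ^+ 2)^-1
                   * (cre x - cconj z).
Proof.
have [b0|b0] := eqVneq (complex.Im z) 0; last first.
  have n0 : (x - complex.Re z) ^+ 2 + complex.Im z ^+ 2 != 0.
    by rewrite gt_eqF // ltr_wpDl ?sqr_ge0 // exprn_even_gt0.
  have h := cre_sub_neq0 x b0.
  apply: (mulfI h); rewrite divff //.
  case: z {h} b0 n0 => a b /= b0 n0.
  by apply: complex_eq => /=; field; rewrite // addrC.
(* For real [z] the identity survives at [x = z] because the inverse of 0 is 0. *)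
case: z b0 => a b /= ->; rewrite expr0n addr0.
have -> : cre x - (a +i* 0)%C = cre (x - a) by apply: complex_eq => /=; ring.
have -> : cre x - cconj (a +i* 0)%C = cre (x - a) by apply: complex_eq => /=; ring.
rewrite /cre -rmorphM -fmorphV; congr _%:C%C.
have [->|h] := eqVneq (x - a) 0; first by rewrite invr0 mulr0.
by rewrite expr2 invfM mulfVK.
Qed.

Lemma ctempered_resolvent (z : R[i]) : complex.Im z != 0 ->
  ctempered (fun x => (cre x - z)^-1).
Proof.
move=> hz; under eq_fun do rewrite inv_cre_sub.
apply: ctemperedM.
  by split; [exact: rtempered_inv_quad|exact: rtempered_cst].
by apply: ctemperedD; [exact: ctempered_cre|exact: ctempered_cst].
Qed.

Definition mtempered m n (F : R -> 'M[R[i]]_(m, n)) :=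
  forall i j, ctempered (fun x => F x i j).

Lemma mtempered_cst m n (C : 'M[R[i]]_(m, n)) : mtempered (fun=> C).
Proof. by move=> i j; exact: ctempered_cst. Qed.

Lemma mtemperedD m n (F G : R -> 'M[R[i]]_(m, n)) : mtempered F -> mtempered G ->
  mtempered (fun x => F x + G x).
Proof.
by move=> hF hG i j; under eq_fun do rewrite mxE; exact: ctemperedD.
Qed.

Lemma mtemperedM m n p (F : R -> 'M[R[i]]_(m, n)) (G : R -> 'M[R[i]]_(n, p)) :
  mtempered F -> mtempered G -> mtempered (fun x => F x *m G x).
Proof.
move=> hF hG i j; under eq_fun do rewrite mxE.
by apply: ctempered_sum => k; exact: ctemperedM.
Qed.

Lemma mtemperedZ m n f (F : R -> 'M[R[i]]_(m, n)) :
  ctempered f -> mtempered F -> mtempered (fun x => f x *: F x).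
Proof.
move=> hF hG i j; under eq_fun do rewrite mxE.
by apply: ctemperedM; [exact: hF|exact: hG].
Qed.

Lemma mtemperedN m n (F : R -> 'M[R[i]]_(m, n)) : mtempered F ->
  mtempered (fun x => - F x).
Proof.
move=> hF; under eq_fun do rewrite -scaleN1r.
by apply: mtemperedZ => //; exact: ctempered_cst.
Qed.

Lemma mtempered_adj m n (F : R -> 'M[R[i]]_(m, n)) :
  mtempered F -> mtempered (fun x => mxadj (F x)).
Proof.
by move=> hF i j; under eq_fun do rewrite !mxE; exact: ctempered_conj.
Qed.

Lemma mtempered_sum m n I (r : seq I) (F : I -> R -> 'M[R[i]]_(m, n)) :
  (forall i, mtempered (F i)) -> mtempered (fun x => \sum_(i <- r) F i x).
Proof.
move=> hF i j; under eq_fun do rewrite summxE.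
by apply: ctempered_sum => k; exact: hF.
Qed.

Lemma mtempered_poly n (p : {poly 'M[R[i]]_n.+1}) :
  mtempered (fun x => mpeval p (cre x)).
Proof.
elim/poly_ind: p => [|p c IH].
  by under eq_fun do rewrite /mpeval horner0; exact: mtempered_cst.
under eq_fun do rewrite /mpeval hornerMXaddC.
apply: mtemperedD; last exact: mtempered_cst.
apply: mtemperedM => // i j; under eq_fun do rewrite mxE.
under eq_fun do rewrite -mulr_natr.
by apply: ctemperedM; [exact: ctempered_cre|exact: ctempered_cst].
Qed.

End ComplexTempered.

(** * Linearity, conjugation and positivity of complex and matrix integrals *)

Section MatrixIntegral.
Variables (R : realType) (tau : {measure set R -> \bar R}).
Implicit Types f g : R -> R[i].

Lemma cintegrableD f g : cintegrable tau f -> cintegrable tau g ->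
  cintegrable tau (fun x => f x + g x).
Proof.
move=> [f1 f2] [g1 g2]; split.
- apply: eq_integrable (integrableD measurableT f1 g1) => // x _.
  by rewrite /= -EFinD complexReD.
- apply: eq_integrable (integrableD measurableT f2 g2) => // x _.
  by rewrite /= -EFinD complexImD.
Qed.

Lemma cintD f g : cintegrable tau f -> cintegrable tau g ->
  cint tau (fun x => f x + g x) = cint tau f + cint tau g.
Proof.
move=> [f1 f2] [g1 g2]; apply: complex_eq; rewrite ?complexReD ?complexImD /=.
- by rewrite -RintegralD //; apply: eq_Rintegral => x _; rewrite complexReD.
- by rewrite -RintegralD //; apply: eq_Rintegral => x _; rewrite complexImD.
Qed.

Lemma cintegrable_lincomb (u v : R -> R) (a b : R) :
  tau.-integrable setT (fun x => (u x)%:E) ->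
  tau.-integrable setT (fun x => (v x)%:E) ->
  tau.-integrable setT (fun x => (a * u x + b * v x)%:E).
Proof.
move=> hu hv.
have := integrableD measurableT (integrableZl measurableT a hu)
          (integrableZl measurableT b hv).
by apply: eq_integrable => // x _ /=; rewrite EFinD !EFinM.
Qed.

Lemma Rintegral_lincomb (u v : R -> R) (a b : R) :
  tau.-integrable setT (fun x => (u x)%:E) ->
  tau.-integrable setT (fun x => (v x)%:E) ->
  Rintegral tau setT (fun x => a * u x + b * v x) =
  a * Rintegral tau setT u + b * Rintegral tau setT v.
Proof.
move=> hu hv; rewrite RintegralD ?RintegralZl //.
- by apply: eq_integrable (integrableZl measurableT a hu) => // x _ /=; rewrite EFinM.
- by apply: eq_integrable (integrableZl measurableT b hv) => // x _ /=; rewrite EFinM.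
Qed.

Lemma cintegrableZ a f : cintegrable tau f -> cintegrable tau (fun x => a * f x).
Proof.
move=> [f1 f2]; split.
- apply: eq_integrable (cintegrable_lincomb (complex.Re a) (- complex.Im a) f1 f2) => // x _.
  by rewrite complexReM mulNr.
- apply: eq_integrable (cintegrable_lincomb (complex.Re a) (complex.Im a) f2 f1) => // x _.
  by rewrite complexImM.
Qed.

Lemma cintZ a f : cintegrable tau f ->
  cint tau (fun x => a * f x) = a * cint tau f.
Proof.
move=> [f1 f2]; apply: complex_eq; rewrite ?complexReM ?complexImM /=.
- rewrite -mulNr -Rintegral_lincomb //; apply: eq_Rintegral => x _.
  by rewrite complexReM mulNr.
- rewrite -Rintegral_lincomb //; apply: eq_Rintegral => x _.
  by rewrite complexImM.
Qed.

Lemma cint0 : cint tau (fun=> 0) = 0.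
Proof.
apply: complex_eq => /=; rewrite /Rintegral.
  by rewrite integral0.
by rewrite integral0.
Qed.

Lemma cintegrable0 : cintegrable tau (fun=> 0).
Proof. by split => /=; exact: integrable0. Qed.

Lemma cintegrable_sum I (r : seq I) (F : I -> R -> R[i]) :
  (forall i, cintegrable tau (F i)) ->
  cintegrable tau (fun x => \sum_(i <- r) F i x).
Proof.
move=> hF; elim: r => [|i r IH].
  by under eq_fun do rewrite big_nil; exact: cintegrable0.
by under eq_fun do rewrite big_cons; exact: cintegrableD.
Qed.

Lemma cint_sum I (r : seq I) (F : I -> R -> R[i]) :
  (forall i, cintegrable tau (F i)) ->
  cint tau (fun x => \sum_(i <- r) F i x) = \sum_(i <- r) cint tau (F i).
Proof.
move=> hF; elim: r => [|i r IH].
  by under eq_fun do rewrite big_nil; rewrite big_nil cint0.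
under eq_fun do rewrite big_cons; rewrite big_cons cintD ?IH //.
exact: cintegrable_sum.
Qed.

Lemma cint_conj f : cintegrable tau f ->
  cint tau (fun x => cconj (f x)) = cconj (cint tau f).
Proof.
move=> [f1 f2]; apply: complex_eq; rewrite ?complexRe_conj ?complexIm_conj /=.
  by apply: eq_Rintegral => x _; rewrite complexRe_conj.
rewrite -mulN1r -RintegralZl //; apply: eq_Rintegral => x _.
by rewrite complexIm_conj mulN1r.
Qed.

Lemma cint_ae_eq f g : cintegrable tau f -> cintegrable tau g ->
  (\forall x \ae tau, f x = g x) -> cint tau f = cint tau g.
Proof.
move=> [/integrableP[f1 _] /integrableP[f2 _]].
move=> [/integrableP[g1 _] /integrableP[g2 _]] fg.
apply: complex_eq => /=; congr fine; apply: ae_eq_integral => //;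
  by apply: filterS fg => x /= -> _.
Qed.

Lemma Re_cint_ge0 f : cintegrable tau f -> (\forall x \ae tau, 0 <= f x) ->
  0 <= complex.Re (cint tau f).
Proof.
move=> hf h.
(* The integrand is nonnegative only almost everywhere; the maximum with 0 has the same integral and
   is nonnegative at every point. *)
rewrite (_ : complex.Re _ =
    Rintegral tau setT (fun x => Num.max (complex.Re (f x)) 0)).
  by apply: Rintegral_ge0 => x _; rewrite le_max lexx orbT.
move: hf => [/integrableP[f1 _] _].
congr fine; apply: ae_eq_integral => //.
  apply/measurable_realfun.measurable_EFinP.
  apply: measurable_realfun.measurable_maxr => //.
  exact/measurable_realfun.measurable_EFinP.
apply: filterS h => x /=; rewrite lecE /= => /andP[_ h] _.
by rewrite max_l.
Qed.

Definition mintegrable m n (F : R -> 'M[R[i]]_(m, n)) :=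
  forall i j, cintegrable tau (fun x => F x i j).

Lemma eq_mint m n (F G : R -> 'M[R[i]]_(m, n)) : F =1 G -> mint tau F = mint tau G.
Proof. by move=> /funext ->. Qed.

Lemma mintD m n (F G : R -> 'M[R[i]]_(m, n)) : mintegrable F -> mintegrable G ->
  mint tau (fun x => F x + G x) = mint tau F + mint tau G.
Proof.
move=> hF hG; apply/matrixP => i j; rewrite !mxE -cintD //.
by congr cint; apply/funext => x; rewrite mxE.
Qed.

Lemma mintZ m n a (F : R -> 'M[R[i]]_(m, n)) : mintegrable F ->
  mint tau (fun x => a *: F x) = a *: mint tau F.
Proof.
move=> hF; apply/matrixP => i j; rewrite !mxE -cintZ //.
by congr cint; apply/funext => x; rewrite mxE.
Qed.

Lemma mintMl m n p (C : 'M[R[i]]_(m, n)) (F : R -> 'M[R[i]]_(n, p)) :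
  mintegrable F -> mint tau (fun x => C *m F x) = C *m mint tau F.
Proof.
move=> hF; apply/matrixP => i j; rewrite !mxE.
under eq_bigr do rewrite mxE -cintZ //.
rewrite -cint_sum => [|k]; last exact: cintegrableZ.
by congr cint; apply/funext => x; rewrite mxE.
Qed.

Lemma mintMr m n p (F : R -> 'M[R[i]]_(m, n)) (C : 'M[R[i]]_(n, p)) :
  mintegrable F -> mint tau (fun x => F x *m C) = mint tau F *m C.
Proof.
move=> hF; apply/matrixP => i j; rewrite !mxE.
under eq_bigr do rewrite mxE mulrC -cintZ //.
rewrite -cint_sum => [|k]; last exact: cintegrableZ.
congr cint; apply/funext => x; rewrite mxE.
by apply: eq_bigr => k _; rewrite mulrC.
Qed.

Lemma mint_adj m n (F : R -> 'M[R[i]]_(m, n)) : mintegrable F ->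
  mint tau (fun x => mxadj (F x)) = mxadj (mint tau F).
Proof.
move=> hF; apply/matrixP => i j; rewrite !mxE -cint_conj //.
by congr cint; apply/funext => x; rewrite !mxE.
Qed.

End MatrixIntegral.

(** * The space L^2(W): sesquilinearity, Bessel's inequality and multiplication by 1/(x - z) *)

Section WeightedForm.
Variables (R : realType) (N : nat) (tau : {measure set R -> \bar R}).
Variable W : R -> 'M[R[i]]_N.
Hypothesis moments :
  forall (k : nat) (i j : 'I_N), cintegrable tau (fun x => cre x ^+ k * W x i j).

(* [wint] is the matrix-valued pairing of L^2(W); for a column [g], [wnorm2 g]
   is its squared norm [\int g^* W g]. *)
Definition wint m p (F : R -> 'M[R[i]]_(m, N)) (G : R -> 'M[R[i]]_(N, p)) :
  'M[R[i]]_(m, p) := mint tau (fun x => F x *m W x *m G x).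

Definition wnorm2 (g : R -> 'cV[R[i]]_N) : R :=
  complex.Re (wint (fun x => mxadj (g x)) g 0 0).

Lemma cintegrable_ctemperedM f i j : ctempered f ->
  cintegrable tau (fun x => f x * W x i j).
Proof.
move=> [f1 f2].
have m1 k : tau.-integrable setT (fun x => (x ^+ k * complex.Re (W x i j))%:E).
  have [h _] := moments k i j; apply: eq_integrable h => // x _.
  by rewrite creX complexReM /= mul0r subr0.
have m2 k : tau.-integrable setT (fun x => (x ^+ k * complex.Im (W x i j))%:E).
  have [_ h] := moments k i j; apply: eq_integrable h => // x _.
  by rewrite creX complexImM /= mul0r addr0.
split.
- apply: eq_integrable (cintegrable_lincomb 1 (-1) (integrable_rtemperedM m1 f1)
    (integrable_rtemperedM m2 f2)) => // x _.
  by rewrite complexReM mul1r mulN1r.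
- apply: eq_integrable (cintegrable_lincomb 1 1 (integrable_rtemperedM m2 f1)
    (integrable_rtemperedM m1 f2)) => // x _.
  by rewrite complexImM !mul1r.
Qed.

(** Each entry of the product is a finite sum of entries of [W] with tempered multipliers. *)
Lemma mintegrable_wint m p (F : R -> 'M[R[i]]_(m, N)) (G : R -> 'M[R[i]]_(N, p)) :
  mtempered F -> mtempered G -> mintegrable tau (fun x => F x *m W x *m G x).
Proof.
move=> hF hG i j.
have -> : (fun x => (F x *m W x *m G x) i j) =
    (fun x => \sum_k \sum_l (F x i l * G x k j) * W x l k).
  apply/funext => x; rewrite mxE; apply: eq_bigr => k _.
  by rewrite mxE mulr_suml; apply: eq_bigr => l _; rewrite mulrAC.
apply: cintegrable_sum => k; apply: cintegrable_sum => l.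
apply: cintegrable_ctemperedM; apply: ctemperedM; [exact: hF|exact: hG].
Qed.

Lemma wintDl m p (F F' : R -> 'M[R[i]]_(m, N)) (G : R -> 'M[R[i]]_(N, p)) :
  mtempered F -> mtempered F' -> mtempered G ->
  wint (fun x => F x + F' x) G = wint F G + wint F' G.
Proof.
move=> hF hF' hG; rewrite /wint -mintD; try exact: mintegrable_wint.
by apply: eq_mint => x; rewrite !mulmxDl.
Qed.

Lemma wintDr m p (F : R -> 'M[R[i]]_(m, N)) (G G' : R -> 'M[R[i]]_(N, p)) :
  mtempered F -> mtempered G -> mtempered G' ->
  wint F (fun x => G x + G' x) = wint F G + wint F G'.
Proof.
move=> hF hF' hG; rewrite /wint -mintD; try exact: mintegrable_wint.
by apply: eq_mint => x; rewrite mulmxDr.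
Qed.

Lemma wintMl m p q (C : 'M[R[i]]_(q, m)) (F : R -> 'M[R[i]]_(m, N))
    (G : R -> 'M[R[i]]_(N, p)) : mtempered F -> mtempered G ->
  wint (fun x => C *m F x) G = C *m wint F G.
Proof.
move=> hF hG; rewrite /wint -mintMl; last exact: mintegrable_wint.
by apply: eq_mint => x; rewrite !mulmxA.
Qed.

Lemma wintMr m p q (F : R -> 'M[R[i]]_(m, N)) (G : R -> 'M[R[i]]_(N, p))
    (C : 'M[R[i]]_(p, q)) : mtempered F -> mtempered G ->
  wint F (fun x => G x *m C) = wint F G *m C.
Proof.
move=> hF hG; rewrite /wint -mintMr; last exact: mintegrable_wint.
by apply: eq_mint => x; rewrite !mulmxA.
Qed.

Lemma wintZl m p a (F : R -> 'M[R[i]]_(m, N)) (G : R -> 'M[R[i]]_(N, p)) :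
  mtempered F -> mtempered G -> wint (fun x => a *: F x) G = a *: wint F G.
Proof.
move=> hF hG; rewrite /wint -mintZ; last exact: mintegrable_wint.
by apply: eq_mint => x; rewrite -!scalemxAl.
Qed.

Lemma wintNl m p (F : R -> 'M[R[i]]_(m, N)) (G : R -> 'M[R[i]]_(N, p)) :
  mtempered F -> mtempered G -> wint (fun x => - F x) G = - wint F G.
Proof.
move=> hF hG; have := wintZl (-1) hF hG; rewrite scaleN1r => <-.
by apply: eq_mint => x; rewrite scaleN1r.
Qed.

Lemma wintNr m p (F : R -> 'M[R[i]]_(m, N)) (G : R -> 'M[R[i]]_(N, p)) :
  mtempered F -> mtempered G -> wint F (fun x => - G x) = - wint F G.
Proof.
move=> hF hG; have := wintMr (- 1%:M) hF hG; rewrite mulmxN mulmx1 => <-.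
by apply: eq_mint => x; rewrite !mulmxN !mulmx1.
Qed.

Lemma wint_suml m p I (r : seq I) (F : I -> R -> 'M[R[i]]_(m, N))
    (G : R -> 'M[R[i]]_(N, p)) : (forall i, mtempered (F i)) -> mtempered G ->
  wint (fun x => \sum_(i <- r) F i x) G = \sum_(i <- r) wint (F i) G.
Proof.
move=> hF hG; elim: r => [|i r IH].
  rewrite big_nil.
  (* The empty sum is settled by homogeneity: the pairing of 0 with [G] is 0 times itself. *)
  have h0 : mtempered (fun=> 0 : 'M[R[i]]_(m, N)) := mtempered_cst _.
  rewrite -[RHS](scale0r (wint (fun=> 0) G)) -(wintZl _ h0 hG).
  by apply: eq_mint => x; rewrite big_nil scaler0.
rewrite big_cons -IH -wintDl; [|exact: hF|exact: mtempered_sum|exact: hG].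
by apply: eq_mint => x; rewrite big_cons.
Qed.

Hypothesis herm_psd : \forall x \ae tau, is_hermitian (W x) /\
  forall v : 'cV[R[i]]_N, 0 <= (mxadj v *m W x *m v) 0 0.

(** [W] is Hermitian only almost everywhere, so the two integrands are compared up to a null set. *)
Lemma wint_adj m p (F : R -> 'M[R[i]]_(m, N)) (G : R -> 'M[R[i]]_(N, p)) :
  mtempered F -> mtempered G ->
  mxadj (wint F G) = wint (fun x => mxadj (G x)) (fun x => mxadj (F x)).
Proof.
move=> hF hG; rewrite -mint_adj; last exact: mintegrable_wint.
apply/matrixP => i j; rewrite !mxE; apply: cint_ae_eq.
- have [h1 h2] := mintegrable_wint hF hG j i; split.
    by under eq_fun do rewrite mxadjE complexRe_conj; exact: h1.
  under eq_fun do rewrite mxadjE complexIm_conj.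
  apply: eq_integrable (integrableZl measurableT (-1) h2) => // x _.
  by rewrite mulN1e EFinN.
- by apply: mintegrable_wint; exact: mtempered_adj.
- apply: filterS herm_psd => x [hW _].
  by rewrite !mxadjM mulmxA [mxadj (W x)]hW.
Qed.

Lemma wnorm2_ge0 (g : R -> 'cV[R[i]]_N) : mtempered g ->
  0 <= wnorm2 g.
Proof.
move=> hg; rewrite /wnorm2 mxE; apply: Re_cint_ge0.
  by apply: mintegrable_wint => //; exact: mtempered_adj.
by apply: filterS herm_psd => x [_]; exact.
Qed.

(** Additivity on the left transfers to the right by taking adjoints. *)
Lemma wint_sumr m p I (r : seq I) (F : R -> 'M[R[i]]_(m, N))
    (G : I -> R -> 'M[R[i]]_(N, p)) : mtempered F -> (forall i, mtempered (G i)) ->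
  wint F (fun x => \sum_(i <- r) G i x) = \sum_(i <- r) wint F (G i).
Proof.
move=> hF hG; apply: (can_inj (@mxadjK _ _ _)).
rewrite wint_adj; [|exact: hF|exact: mtempered_sum].
rewrite mxadj_sum; under eq_bigr do rewrite wint_adj //.
rewrite -wint_suml; [|by move=> i; exact: mtempered_adj|exact: mtempered_adj].
by apply: eq_mint => x; rewrite mxadj_sum.
Qed.

Variable p : nat -> R -> 'M[R[i]]_N.
Hypothesis p_tempered : forall k, mtempered (p k).
Hypothesis p_orthonormal :
  forall k l, wint (p k) (fun x => mxadj (p l x)) = (k == l)%:R%:M.

(** The pairing has [p n] on the left, so the expansion with Fourier coefficients [v k] is built
    from the adjoints of the [p k]. Orthonormality leaves a single term, present when [n < K]. *)
Lemma wint_orthonormal_comb n (v : nat -> 'cV[R[i]]_N) K :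
  wint (p n) (fun x => \sum_(k < K) mxadj (p k x) *m v k) =
  if (n < K)%N then v n else 0.
Proof.
have ha k := mtempered_adj (p_tempered k).
rewrite wint_sumr // => [|k]; last by apply: mtemperedM => //; exact: mtempered_cst.
under eq_bigr do rewrite wintMr // p_orthonormal mul_scalar_mx.
case: ltnP => hn; last first.
  apply: big1 => i _; rewrite gtn_eqF ?scale0r //.
  exact: leq_trans (ltn_ord i) hn.
rewrite (bigD1 (Ordinal hn)) //= eqxx scale1r big1 ?addr0 // => i hi.
have -> : (n == i :> nat) = false by apply/negbTE; rewrite eq_sym; exact: hi.
by rewrite scale0r.
Qed.

Lemma wnorm2_comb (v : nat -> 'cV[R[i]]_N) K :
  wnorm2 (fun x => \sum_(k < K) mxadj (p k x) *m v k) = \sum_(k < K) vnorm2 (v k).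
Proof.
set s := fun x => _; rewrite /wnorm2.
have ha k := mtempered_adj (p_tempered k).
have hs : mtempered s.
  by apply: mtempered_sum => k; apply: mtemperedM => //; exact: mtempered_cst.
have -> : (fun x => mxadj (s x)) = (fun x => \sum_(k < K) mxadj (v k) *m p k x).
  apply/funext => x; rewrite mxadj_sum; apply: eq_bigr => k _.
  by rewrite mxadjM mxadjK.
rewrite wint_suml // => [|k]; last by apply: mtemperedM => //; exact: mtempered_cst.
rewrite summxE raddf_sum; apply: eq_bigr => k _.
by rewrite wintMl // wint_orthonormal_comb ltn_ord mxadj_mul_vnorm2.
Qed.

(** With [s] the projection of [g] on the first [K] elements of the system, both cross terms and the
    squared norm of [s] equal the sum of the squared coefficients. The claim is then that [g - s]
    has nonnegative squared norm. *)
Lemma bessel (g : R -> 'cV[R[i]]_N) K : mtempered g ->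
  \sum_(k < K) vnorm2 (wint (p k) g) <= wnorm2 g.
Proof.
move=> hg; set c := fun k => wint (p k) g.
pose s := fun x => \sum_(k < K) mxadj (p k x) *m c k.
have ha k := mtempered_adj (p_tempered k).
have hs : mtempered s.
  by apply: mtempered_sum => k; apply: mtemperedM => //; exact: mtempered_cst.
have sg : wint (fun x => mxadj (s x)) g = \sum_(k < K) mxadj (c k) *m c k.
  have -> : (fun x => mxadj (s x)) = (fun x => \sum_(k < K) mxadj (c k) *m p k x).
    apply/funext => x; rewrite mxadj_sum; apply: eq_bigr => k _.
    by rewrite mxadjM mxadjK.
  rewrite wint_suml // => [|k]; last by apply: mtemperedM => //; exact: mtempered_cst.
  by apply: eq_bigr => k _; rewrite wintMl.
have gs : wint (fun x => mxadj (g x)) s = \sum_(k < K) mxadj (c k) *m c k.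
  apply: (can_inj (@mxadjK _ _ _)); rewrite wint_adj; [|exact: mtempered_adj|exact: hs].
  under [X in wint _ X]eq_fun do rewrite mxadjK.
  by rewrite sg mxadj_sum; apply: eq_bigr => k _; rewrite mxadjM mxadjK.
have hgs : mtempered (fun x => g x - s x).
  by apply: mtemperedD => //; exact: mtemperedN.
have := wnorm2_ge0 hgs; rewrite /wnorm2.
have -> : (fun x => mxadj (g x - s x)) = (fun x => mxadj (g x) + - mxadj (s x)).
  by apply/funext => x; rewrite mxadjB.
have hN := mtemperedN hs.
have a1 := mtempered_adj hg.
have a2 := mtempered_adj hs.
have a3 := mtemperedN a2.
rewrite wintDl // !wintDr // !wintNr // !wintNl // gs sg.
have expand (X Y Z : 'M[R[i]]_1) : complex.Re ((X - Y + (- Y - - Z)) 0 0) =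
    complex.Re (X 0 0) - complex.Re (Y 0 0) *+ 2 + complex.Re (Z 0 0).
  rewrite !mxE; case: (X 0 0) => ? ?; case: (Y 0 0) => ? ?; case: (Z 0 0) => ? ? /=.
  by ring.
rewrite expand [X in _ + X](wnorm2_comb c K).
have -> : complex.Re ((\sum_(k < K) mxadj (c k) *m c k) 0 0) =
    \sum_(k < K) vnorm2 (c k).
  by rewrite summxE raddf_sum; apply: eq_bigr => k _; rewrite mxadj_mul_vnorm2.
by rewrite /c; lra.
Qed.

Lemma wnorm2_resolvent_le (g : R -> 'cV[R[i]]_N) (z : R[i]) : complex.Im z != 0 ->
  mtempered g ->
  wnorm2 (fun x => (cre x - z)^-1 *: g x) <= (complex.Im z ^+ 2)^-1 * wnorm2 g.
Proof.
move=> hz hg; set h := fun x => _; have b2 : 0 < complex.Im z ^+ 2 by rewrite exprn_even_gt0.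
have hh : mtempered h by apply: mtemperedZ => //; exact: ctempered_resolvent.
pose a := complex.Re z; pose h' := fun x => cre (x - a) *: h x.
have ha : ctempered (fun x => cre (x - a)).
  by split; [apply: rtemperedD; [exact: rtempered_id|exact: rtempered_cst]|exact: rtempered_cst].
have hh' : mtempered h' by apply: mtemperedZ.
(* [g] splits as [(x - z) h], and [|x - z|^2 = (x - Re z)^2 + (Im z)^2]. *)
have split_g : wint (fun x => mxadj (g x)) g =
    cre (complex.Im z ^+ 2) *: wint (fun x => mxadj (h x)) h +
    wint (fun x => mxadj (h' x)) h'.
  have ah := mtempered_adj hh; have ah' := mtempered_adj hh'.
  rewrite /wint -mintZ; last exact: mintegrable_wint.
  rewrite -mintD; [|move=> i j|exact: mintegrable_wint]; last first.
    have := cintegrableZ (cre (complex.Im z ^+ 2)) (mintegrable_wint ah hh i j).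
    by congr cintegrable; apply/funext => x; rewrite [RHS]mxE.
  apply: eq_mint => x.
  have -> : g x = (cre x - z) *: h x.
    by rewrite /h scalerA divff ?scale1r // cre_sub_neq0.
  rewrite /h' !mxadjZ -!scalemxAl -!scalemxAr !scalerA -scalerDl.
  congr (_ *: _); rewrite /a; case: z {hz b2 h hh a h' ha hh' ah ah'} => a b.
  by apply: complex_eq => /=; ring.
have expand (c : R) (X Y : 'M[R[i]]_1) : complex.Re ((cre c *: X + Y) 0 0) =
    c * complex.Re (X 0 0) + complex.Re (Y 0 0).
  by rewrite !mxE complexReD complexReM /= mul0r subr0.
by rewrite /wnorm2 split_g ler_pdivlMl // expand lerDl; exact: wnorm2_ge0.
Qed.

End WeightedForm.

(** * Entrywise limits of vector sequences *)

Section ComponentwiseLimits.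
Variables (R : realType) (N : nat).
Implicit Types (u v : nat -> 'cV[R[i]]_N) (l : 'cV[R[i]]_N).

Definition ccvg (a : nat -> R[i]) (b : R[i]) :=
  ((fun M => complex.Re (a M)) @ \oo --> complex.Re b) /\
  ((fun M => complex.Im (a M)) @ \oo --> complex.Im b).

Lemma ccvgD a b c d : ccvg a b -> ccvg c d -> ccvg (fun M => a M + c M) (b + d).
Proof.
move=> [a1 a2] [c1 c2]; split.
- by rewrite complexReD; under eq_fun do rewrite complexReD; exact: cvgD.
- by rewrite complexImD; under eq_fun do rewrite complexImD; exact: cvgD.
Qed.

Lemma ccvgZ e a b : ccvg a b -> ccvg (fun M => e * a M) (e * b).
Proof.
move=> [a1 a2]; split.
- rewrite complexReM; under eq_fun do rewrite complexReM.
  by apply: cvgB; apply: cvgM => //; exact: cvg_cst.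
- rewrite complexImM; under eq_fun do rewrite complexImM.
  by apply: cvgD; apply: cvgM => //; exact: cvg_cst.
Qed.

Lemma ccvg_cst b : ccvg (fun=> b) b.
Proof. by split; exact: cvg_cst. Qed.

Lemma ccvg_sum I (r : seq I) (a : I -> nat -> R[i]) (b : I -> R[i]) :
  (forall i, ccvg (a i) (b i)) ->
  ccvg (fun M => \sum_(i <- r) a i M) (\sum_(i <- r) b i).
Proof.
move=> h; elim: r => [|i r IH].
  by rewrite big_nil; under eq_fun do rewrite big_nil; exact: ccvg_cst.
by rewrite big_cons; under eq_fun do rewrite big_cons; exact: ccvgD.
Qed.

Lemma cvgn_sum I (r : seq I) (a : I -> nat -> R) (b : I -> R) :
  (forall i, a i @ \oo --> b i) ->
  (fun M => \sum_(i <- r) a i M) @ \oo --> \sum_(i <- r) b i.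
Proof.
move=> h; elim: r => [|i r IH].
  by rewrite big_nil; under eq_fun do rewrite big_nil; exact: cvg_cst.
by rewrite big_cons; under eq_fun do rewrite big_cons; apply: cvgD.
Qed.

Definition vcvg m (u : nat -> 'cV[R[i]]_m) (l : 'cV[R[i]]_m) :=
  forall j, ccvg (fun M => u M j 0) (l j 0).

Lemma vcvgD u v l l' : vcvg u l -> vcvg v l' -> vcvg (fun M => u M + v M) (l + l').
Proof.
by move=> hu hv j; rewrite mxE; under eq_fun do rewrite mxE; exact: ccvgD.
Qed.

Lemma vcvg_mulmx (C : 'M[R[i]]_N) u l : vcvg u l -> vcvg (fun M => C *m u M) (C *m l).
Proof.
move=> hu j; rewrite mxE; under eq_fun do rewrite mxE.
by apply: ccvg_sum => k; apply: ccvgZ; exact: hu.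
Qed.

Lemma vcvgZ e u l : vcvg u l -> vcvg (fun M => e *: u M) (e *: l).
Proof.
by move=> hu j; rewrite mxE; under eq_fun do rewrite mxE; apply: ccvgZ; exact: hu.
Qed.

Lemma vcvg_near_cst u l K : (forall M, (K <= M)%N -> u M = l) -> vcvg u l.
Proof.
move=> h j; split; apply: cvg_near_cst; exists K => // M /= KM; by rewrite h.
Qed.

Lemma vcvg_unique u l l' : vcvg u l -> vcvg u l' -> l = l'.
Proof.
move=> h h'; apply/matrixP => i j; rewrite (ord1 j).
have [a1 a2] := h i; have [b1 b2] := h' i.
apply: complex_eq; [exact: (cvg_unique _ a1 b1)|exact: (cvg_unique _ a2 b2)].
Qed.

Lemma vcvg_vnorm2 u l : vcvg u l -> (fun M => vnorm2 (u M)) @ \oo --> vnorm2 l.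
Proof.
move=> h; rewrite /vnorm2; apply: cvgn_sum => i.
have [a1 a2] := h i.
by apply: cvgD; rewrite expr2; under eq_fun do rewrite expr2; exact: cvgM.
Qed.

(** [limn] is total, so this vector carries information only when the entries converge, as [vlimP]
    ensures. *)
Definition vlim u : 'cV[R[i]]_N :=
  \col_j (limn (fun M => complex.Re (u M j 0)) +i*
          limn (fun M => complex.Im (u M j 0)))%C.

(** The Cauchy property passes from [s] to [a], since squared increments of [a] are controlled by
    increments of [s]. *)
Lemma cvg_sqr_dist_le (a s : nat -> R) c :
  (forall M M', (M <= M')%N -> (a M' - a M) ^+ 2 <= c * (s M' - s M)) ->
  cvgn s -> cvgn a.
Proof.
move=> h /cvg_cauchy/cauchyP hs; apply: cauchy_cvg; apply: cauchy_exP => e e0.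
(* No sign is assumed for [c]; [|c| + 1] is a positive bound for it. The final division by 2 below
   is there because [s K] and [s M] are compared through the centre [l] of a ball that contains
   both. *)
have c0 : 0 < `|c| + 1 by rewrite ltr_pwDr.
have d0 : 0 < e ^+ 2 / (`|c| + 1) / 2 by rewrite !divr_gt0 // exprn_gt0.
have [l [K _ hK]] := hs _ d0.
exists (a K), K => // M /= KM; rewrite /ball /=.
have hKM := h _ _ KM.
have sM : `|s M - s K| < e ^+ 2 / (`|c| + 1).
  have := hK M KM; have := hK K (leqnn K); rewrite /ball /= => h1 h2.
  rewrite (_ : s M - s K = (l - s K) - (l - s M)); last by ring.
  by apply: le_lt_trans (ler_normB _ _) _; rewrite [ltRHS]splitr ltrD.
suff : `|a K - a M| ^+ 2 < e ^+ 2.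
  by rewrite ltr_pXn2r // nnegrE ?normr_ge0 // ltW.
rewrite real_normK ?num_real // -sqrrN opprB.
apply: le_lt_trans hKM _; apply: le_lt_trans (ler_norm _) _; rewrite normrM.
apply: (@le_lt_trans _ _ ((`|c| + 1) * `|s M - s K|)).
  by rewrite ler_wpM2r // lerDl.
by rewrite mulrC -ltr_pdivlMr.
Qed.

Lemma vnorm2_ge0 l : 0 <= vnorm2 l.
Proof. by apply: sumr_ge0 => i _; rewrite addr_ge0 ?sqr_ge0. Qed.

(** The squared increment of each real coordinate is at most that of the whole vector, so every
    coordinate is Cauchy. *)
Lemma vlimP u (s : nat -> R) c :
  (forall M M', (M <= M')%N -> vnorm2 (u M' - u M) <= c * (s M' - s M)) ->
  cvgn s -> vcvg u (vlim u).
Proof.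
move=> h hs j; rewrite mxE.
have hj M M' : (M <= M')%N ->
    (complex.Re (u M' j 0) - complex.Re (u M j 0)) ^+ 2 +
    (complex.Im (u M' j 0) - complex.Im (u M j 0)) ^+ 2 <= c * (s M' - s M).
  move=> /h; apply: le_trans; rewrite /vnorm2 (bigD1 j) //= !mxE.
  rewrite !complexReD !complexImD !raddfN lerDl.
  by apply: sumr_ge0 => i _; rewrite addr_ge0 ?sqr_ge0.
split => /=.
- apply: (@cvg_sqr_dist_le _ s c) => // M M' /hj; apply: le_trans.
  by rewrite lerDl sqr_ge0.
- apply: (@cvg_sqr_dist_le _ s c) => // M M' /hj; apply: le_trans.
  by rewrite lerDr sqr_ge0.
Qed.

End ComponentwiseLimits.

(** * Square-summable sequences *)

Section SquareSummable.
Variables (R : realType) (N : nat).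
Implicit Types (U V : nat -> 'cV[R[i]]_N).

Let nd U : {homo series (fun k => vnorm2 (U k)) : m n / (m <= n)%N >-> m <= n}.
Proof. by apply/nondecreasing_series => k _ _; exact: vnorm2_ge0. Qed.

Lemma l2_partial_le U K : l2 U -> \sum_(k < K) vnorm2 (U k) <= l2norm2 U.
Proof.
move=> hU; rewrite -(big_mkord xpredT (fun k => vnorm2 (U k))).
exact: (nondecreasing_cvgn_le (@nd U) hU).
Qed.

Lemma l2_of_bounded U c :
  (forall K, \sum_(k < K) vnorm2 (U k) <= c) -> l2 U /\ l2norm2 U <= c.
Proof.
move=> h.
have h' K : series (fun k => vnorm2 (U k)) K <= c by rewrite /series /= big_mkord.
have hU : l2 U.
  by apply: nondecreasing_is_cvgn; [exact: nd|exists c => _ [K _ <-]].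
by split => //; apply: limr_le => //; exists 0%N.
Qed.

(** Parallelogram law: the right side exceeds the left by the squared norm of [a *: u - v]. *)
Lemma vnorm2_lincomb a (u v : 'cV[R[i]]_N) : vnorm2 (a *: u + v) <=
  2 * (complex.Re a ^+ 2 + complex.Im a ^+ 2) * vnorm2 u + 2 * vnorm2 v.
Proof.
rewrite /vnorm2 !mulr_sumr -big_split; apply: ler_sum => i _ /=; rewrite !mxE.
case: (u i 0) => x y; case: (v i 0) => s t; case: a => p q /=.
have : 0 <= (p * x - q * y - s) ^+ 2 + (p * y + q * x - t) ^+ 2.
  by rewrite addr_ge0 ?sqr_ge0.
by rewrite -subr_ge0 => h; rewrite -subr_ge0; apply: le_trans h _; rewrite le_eqVlt;
  apply/orP; left; apply/eqP; ring.
Qed.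

Lemma l2_lincomb a U V : l2 U -> l2 V -> l2 (fun k => a *: U k + V k).
Proof.
move=> hU hV.
apply: (proj1 (l2_of_bounded (c := 2 * (complex.Re a ^+ 2 + complex.Im a ^+ 2)
  * l2norm2 U + 2 * l2norm2 V) _)) => K.
apply: (@le_trans _ _ (2 * (complex.Re a ^+ 2 + complex.Im a ^+ 2)
  * (\sum_(k < K) vnorm2 (U k)) + 2 * (\sum_(k < K) vnorm2 (V k)))).
  by rewrite !mulr_sumr -big_split; apply: ler_sum => i _; exact: vnorm2_lincomb.
have a0 : 0 <= complex.Re a ^+ 2 + complex.Im a ^+ 2 by rewrite addr_ge0 ?sqr_ge0.
by rewrite lerD // ler_wpM2l ?mulr_ge0 //; exact: l2_partial_le.
Qed.

End SquareSummable.

(** * The three-term recurrence on block columns *)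

Section JacobiRows.
Variables (R : realType) (N : nat) (A B : nat -> 'M[R[i]]_N).

(* [Jac] acting on columns of matrix blocks. *)
Definition jrow p (f : nat -> 'M[R[i]]_(N, p)) (k : nat) : 'M[R[i]]_(N, p) :=
  A k *m f k.+1 + B k *m f k + (if k is m.+1 then mxadj (A m) *m f m else 0).

Lemma Jac_jrow V : Jac A B V = jrow V.
Proof. by apply/funext => -[|k]; rewrite /jrow ?addr0. Qed.

Lemma jrowMr p q (f : nat -> 'M[R[i]]_(N, p)) (C : 'M[R[i]]_(p, q)) k :
  jrow (fun i => f i *m C) k = jrow f k *m C.
Proof. by rewrite /jrow !mulmxDl !mulmxA; case: k => [|k]; rewrite ?mul0mx ?mulmxA. Qed.

Lemma jrowD p (f g : nat -> 'M[R[i]]_(N, p)) k :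
  jrow (fun i => f i + g i) k = jrow f k + jrow g k.
Proof.
rewrite /jrow !mulmxDr; case: k => [|k]; first by rewrite !addr0 addrACA.
by rewrite mulmxDr [RHS]addrACA; congr (_ + _); rewrite addrACA.
Qed.

Lemma jrowZ p a (f : nat -> 'M[R[i]]_(N, p)) k :
  jrow (fun i => a *: f i) k = a *: jrow f k.
Proof.
by rewrite /jrow !scalerDr -!scalemxAr; case: k => [|k]; rewrite ?scaler0 ?scalemxAr.
Qed.

(** Since [A k] is invertible, row [k] determines entry [k + 1] from the two before it. Rows below
    [K] thus reach entry [K] included, which lets [green_le] cover the diagonal; the same lemma
    identifies formal eigenvectors in the uniqueness argument. *)
Lemma jrow_eigen0 p (f : nat -> 'M[R[i]]_(N, p)) z K :
  (forall k, A k \in unitmx) -> f 0%N = 0 ->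
  (forall k, (k < K)%N -> jrow f k = z *: f k) ->
  forall k, (k <= K)%N -> f k = 0.
Proof.
move=> uA f0 hf; elim/ltn_ind => -[//|k] IH hk.
have := hf k hk; rewrite /jrow (IH k) ?(ltnW hk) // mulmx0 addr0 scaler0.
have -> : (if k is m.+1 then mxadj (A m) *m f m else 0) = 0.
  by case: k {hf} IH hk => // k IH hk; rewrite (IH k) ?mulmx0 // (ltnW (ltnW hk)).
by rewrite addr0 => /(congr1 (mulmx (invmx (A k)))); rewrite mulKmx // mulmx0.
Qed.

End JacobiRows.

(** * The kernel of 1/(x - z) in the orthonormal system, and its identification with [Gz] *)

Section GreenKernel.
Variables (R : realType) (n : nat) (tau : {measure set R -> \bar R}).
Variables (W : R -> 'M[R[i]]_n.+1) (P : nat -> {poly 'M[R[i]]_n.+1}).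
Variables (A B : nat -> 'M[R[i]]_n.+1).
Hypothesis moments :
  forall (k : nat) (i j : 'I_n.+1), cintegrable tau (fun x => cre x ^+ k * W x i j).
Hypothesis herm_psd : \forall x \ae tau, is_hermitian (W x) /\
  forall v : 'cV[R[i]]_n.+1, 0 <= (mxadj v *m W x *m v) 0 0.
Hypothesis P_orthonormal : forall k l,
  mint tau (fun x => mpeval (P k) (cre x) *m W x *m mxadj (mpeval (P l) (cre x)))
  = (k == l)%:R%:M.
Hypothesis P_cst : forall z w, mpeval (P 0%N) z = mpeval (P 0%N) w.
Hypothesis A_unit : forall k, A k \in unitmx.
Hypothesis P_rec : forall k z,
  jrow A B (fun i => mpeval (P i) z) k = z *: mpeval (P k) z.

Local Notation p k := (fun x : R => mpeval (P k) (cre x)).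
Local Notation pa k := (fun x : R => mxadj (mpeval (P k) (cre x))).
Local Notation res z := (fun x : R => (cre x - z)^-1).

Lemma tempered_p k : mtempered (p k).
Proof. exact: mtempered_poly. Qed.
Lemma tempered_pa k : mtempered (pa k).
Proof. by apply: mtempered_adj; exact: tempered_p. Qed.
Lemma tempered_resZ (z : R[i]) m q (F : R -> 'M[R[i]]_(m, q)) :
  complex.Im z != 0 -> mtempered F -> mtempered (fun x => res z x *: F x).
Proof. by move=> hz hF; apply: mtemperedZ => //; exact: ctempered_resolvent. Qed.

(* The matrix elements of multiplication by [1 / (x - z)] on L^2(W) in the
   orthonormal system [P]. *)
Definition green (z : R[i]) (i k : nat) : 'M[R[i]]_n.+1 :=
  wint tau W (fun x => res z x *: p i x) (pa k).

Lemma conj_res (z : R[i]) x : cconj (res z x) = res (cconj z) x.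
Proof.
rewrite /cconj fmorphV; congr (_^-1).
by case: z => a b; apply: complex_eq => /=; ring.
Qed.

Lemma Im_conj_neq0 (z : R[i]) : complex.Im z != 0 -> complex.Im (cconj z) != 0.
Proof. by rewrite complexIm_conj oppr_eq0. Qed.

(** The recurrence turns [P k] into x times itself, and x / (x - z) = z / (x - z) + 1. The summand 1
    contributes the orthonormality integral, hence the Kronecker term. *)
Lemma green_rec z k l : complex.Im z != 0 ->
  jrow A B (fun i => green z i l) k = z *: green z k l + (k == l)%:R%:M.
Proof.
move=> hz; have hr i := tempered_resZ hz (tempered_p i).
have hl := tempered_pa l.
have hM C i : mtempered (fun x => C *m (res z x *: p i x)).
  by apply: mtemperedM; [exact: mtempered_cst|exact: hr].
have -> : jrow A B (fun i => green z i l) k =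
    wint tau W (fun x => jrow A B (fun i => res z x *: p i x) k) (pa l).
  rewrite /jrow /green -!wintMl //.
  rewrite -wintDl //; case: k => [|k].
    by rewrite addr0; apply: eq_mint => x; rewrite addr0.
  rewrite -wintMl // -wintDl //; exact: mtemperedD.
have kl : wint tau W (p k) (pa l) = (k == l)%:R%:M := P_orthonormal k l.
have hzr : mtempered (fun x => z *: (res z x *: p k x)).
  by apply: mtemperedZ; [exact: ctempered_cst|exact: hr].
rewrite -kl /green -(wintZl _ _ (hr k) hl) //.
apply: etrans (wintDl moments hzr (tempered_p k) hl).
apply: eq_mint => x; congr (_ *m _ *m _).
rewrite jrowZ P_rec !scalerA -[X in _ = _ + X]scale1r -scalerDl; congr (_ *: _).
have u0 := cre_sub_neq0 x hz.
apply: (mulfI u0); rewrite mulrA divff // mul1r mulrDr mulr1.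
by rewrite [X in _ = X + _]mulrC divfK // addrC subrK.
Qed.

Lemma green_adj z i k : complex.Im z != 0 ->
  mxadj (green z i k) = green (cconj z) k i.
Proof.
move=> hz; have hr := tempered_resZ hz (tempered_p i).
rewrite /green (wint_adj moments herm_psd hr (tempered_pa k)).
by apply: eq_mint => x; rewrite mxadjK mxadjZ -conj_res -!scalemxAl -!scalemxAr.
Qed.

Lemma green_le z i k : complex.Im z != 0 -> (i <= k)%N ->
  green z i k = mpeval (P i) z *m wint tau W (fun x => res z x *: 1%:M) (pa k).
Proof.
move=> hz ik; apply/eqP; rewrite -subr_eq0; apply/eqP.
have h1 : mtempered (fun x => res z x *: (1%:M : 'M[R[i]]_n.+1)).
  by apply: tempered_resZ => //; exact: mtempered_cst.
set S := wint _ _ _ _.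
pose f j := green z j k + mpeval (P j) z *m (- S).
rewrite -mulmxN -[LHS]/(f i).
apply: (@jrow_eigen0 R n.+1 A B n.+1 f z k) => // [|j jk].
  (* Initial value: [P 0] does not depend on its argument, so it leaves the integral. *)
  rewrite /f mulmxN; apply/eqP; rewrite subr_eq0 /S /green.
  rewrite -(wintMl moments _ h1 (tempered_pa k)).
  apply/eqP/eq_mint => x; rewrite (P_cst (cre x) z).
  by rewrite -scalemxAr mulmx1.
(* The Kronecker source sits in row [k], so all rows [j < k] are homogeneous. *)
rewrite /f jrowD jrowMr green_rec // P_rec ltn_eqF // -scalemxAl scalerDr.
by rewrite (raddf0 (@scalar_mx _ _)) addr0.
Qed.

(** The integrand of [Qpol] is (P_k(x) - P_k(z)) W / (x - z); adding P_k(z) times the Stieltjes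
    integrand cancels the terms in P_k(z). *)
Lemma Ffun_wint k z : complex.Im z != 0 ->
  Ffun tau W P k z = wint tau W (fun x => res z x *: p k x) (fun=> 1%:M).
Proof.
move=> hz; have h1 : mtempered (fun=> 1%:M : 'M[R[i]]_n.+1) by exact: mtempered_cst.
have hr1 := tempered_resZ hz h1.
have hd : mtempered (fun x => mpeval (P k) z - p k x).
  by apply: mtemperedD; [exact: mtempered_cst|apply: mtemperedN; exact: tempered_p].
have hrd := mtemperedN (tempered_resZ hz hd).
have hC : mtempered (fun x => mpeval (P k) z *m (res z x *: (1%:M : 'M[R[i]]_n.+1))).
  by apply: mtemperedM => //; exact: mtempered_cst.
have eQ : Qpol tau W P k z =
    wint tau W (fun x => - (res z x *: (mpeval (P k) z - p k x))) (fun=> 1%:M).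
  apply: eq_mint => x.
  by rewrite mulmx1 -opprB invrN scaleNr mulNmx scalemxAl.
have eS : stieltjes tau W z = wint tau W (fun x => res z x *: 1%:M) (fun=> 1%:M).
  by apply: eq_mint => x; rewrite mulmx1 -scalemxAl mul1mx.
rewrite /Ffun eQ eS.
rewrite -(wintMl moments _ hr1 h1).
apply: etrans (esym (wintDl moments hrd hC h1)) _; apply: eq_mint => x.
congr (_ *m W x *m _); by rewrite -scalemxAr mulmx1 -scalerN -scalerDr opprB subrK.
Qed.

(** This recognises the right factor in [green_le]; the conjugation of [z] inside [fstar] is undone
    by the adjoint of the resolvent factor. *)
Lemma fstar_Ffun k z : complex.Im z != 0 ->
  fstar (Ffun tau W P k) z = wint tau W (fun x => res z x *: 1%:M) (pa k).
Proof.
move=> hz; have hz' := Im_conj_neq0 hz.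
have hr := tempered_resZ hz' (tempered_p k).
have h1 : mtempered (fun=> 1%:M : 'M[R[i]]_n.+1) by exact: mtempered_cst.
rewrite /fstar (Ffun_wint _ hz') (wint_adj moments herm_psd hr h1).
apply: eq_mint => x.
by rewrite mxadj1 mxadjZ conj_res cconjK -!scalemxAl -!scalemxAr.
Qed.

Lemma Gz_green z i k : complex.Im z != 0 -> Gz tau W P z i k = green z i k.
Proof.
move=> hz; rewrite /Gz; case: leqP => ik; first by rewrite (fstar_Ffun _ hz) -(green_le hz ik).
(* Below the diagonal, the factorisation is applied at the conjugate of [z] with the indices
   exchanged, and its adjoint is taken. *)
have hz' := Im_conj_neq0 hz.
rewrite -[RHS]mxadjK (green_adj _ _ hz) (green_le hz' (ltnW ik)).
by rewrite mxadjM -(fstar_Ffun _ hz') /fstar cconjK mxadjK.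
Qed.

Lemma green_bounded z (V : nat -> 'cV[R[i]]_n.+1) K M : complex.Im z != 0 ->
  \sum_(i < K) vnorm2 (\sum_(k < M) green z i k *m V k) <=
  (complex.Im z ^+ 2)^-1 * \sum_(k < M) vnorm2 (V k).
Proof.
(* [g] has Fourier coefficients [V k], so its squared norm is the sum on the right, and the i-th
   coefficient of g / (x - z) is entry [i] of the kernel applied to [V]. *)
move=> hz; pose g x := \sum_(k < M) pa k x *m V k.
have hk k : mtempered (fun x => pa k x *m V k).
  by apply: mtemperedM; [exact: tempered_pa|exact: mtempered_cst].
have hg : mtempered g by apply: mtempered_sum => k; exact: hk.
have hrg := tempered_resZ hz hg.
rewrite -(wnorm2_comb moments herm_psd tempered_p P_orthonormal V M).
apply: le_trans (wnorm2_resolvent_le moments herm_psd hz hg).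
apply: le_trans (bessel moments herm_psd tempered_p P_orthonormal K hrg).
apply: ler_sum => i _; rewrite le_eqVlt; apply/orP; left; apply/eqP.
congr vnorm2; have hri := tempered_resZ hz (tempered_p i).
have -> : wint tau W (p i) (fun x => res z x *: g x) =
    wint tau W (fun x => res z x *: p i x) g.
  by apply: eq_mint => x; rewrite -!scalemxAl -!scalemxAr.
rewrite (wint_sumr moments herm_psd _ hri (fun k : 'I_M => hk k)); apply: eq_bigr => k _.
by rewrite (wintMr moments _ hri (tempered_pa k)).
Qed.

End GreenKernel.

(** * The adjoint of the Jacobi operator as the formal recurrence on its maximal domain *)

Section AdjointJacobi.
Variables (R : realType) (N : nat) (A B : nat -> 'M[R[i]]_N).
Hypothesis B_herm : forall k, is_hermitian (B k).
Implicit Types U V Y : nat -> 'cV[R[i]]_N.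

(** Discrete Green formula: the [B] terms cancel by self-adjointness, the [A] terms of neighbouring
    rows cancel in pairs, and only the boundary at [K] survives. *)
Lemma jacobi_green_formula U V K :
  \sum_(k < K.+1) mxadj (U k) *m jrow A B V k -
  \sum_(k < K.+1) mxadj (jrow A B U k) *m V k =
  mxadj (U K) *m A K *m V K.+1 - mxadj (U K.+1) *m mxadj (A K) *m V K.
Proof.
elim: K => [|K IH].
  rewrite !big_ord_recl !big_ord0 !addr0 /jrow !addr0 mxadjD !mxadjM B_herm.
  by rewrite mulmxDr mulmxDl !mulmxA opprD addrACA subrr addr0.
rewrite big_ord_recr [X in _ - X]big_ord_recr /= opprD addrACA IH /jrow.
rewrite !mxadjD !mxadjM mxadjK B_herm !mulmxDr !mulmxDl !mulmxA.
have cancel (a b c d e : 'M[R[i]]_1) : a - b + (c + d + b - (e + d + a)) = c - e.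
  have -> : c + d + b - (e + d + a) = c - e + (b - a).
    by rewrite opprD addrACA [e + d]addrC opprD (addrA (c + d)) addrK.
  by rewrite addrC -addrA (addrA (b - a)) subrK subrr addr0.
exact: cancel.
Qed.

Lemma Jadj_formal U Y : Jadj A B U Y -> forall k, Y k = jrow A B U k.
Proof.
move=> [_ [_ h]] k; apply/eqP; rewrite -subr_eq0; apply/eqP/matrixP => i j.
(* Testing against a unit vector at site [k] isolates one coordinate. Green's formula is taken up to
   [k + 1], where both boundary values of [V] vanish. *)
pose V l : 'cV[R[i]]_N := if l == k then delta_mx i 0 else 0.
have sV : supp_below k.+1 V.
  by move=> l kl; rewrite /V gtn_eqF.
have := h _ _ sV; have := jacobi_green_formula U V k.+1.
rewrite /V !gtn_eqF // !mulmx0 subrr -/V => /eqP; rewrite subr_eq0 => /eqP.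
rewrite Jac_jrow /ipfin => -> /eqP; rewrite -subr_eq0 -sumrB.
have kk : (k < k.+2)%N by rewrite ltnS leqnSn.
rewrite (bigD1 (Ordinal kk)) //= big1 => [|l lk]; last first.
  by rewrite /V ifN ?mulmx0 ?subrr.
rewrite addr0 /V eqxx -mulmxBl -mxadjB -[Y k - _]opprB; set D := jrow A B U k - Y k.
rewrite -colE => /eqP/matrixP/(_ 0 0); rewrite mxE mxadjE.
move=> /(congr1 (@cconj R)); rewrite cconjK !mxE (ord1 j) => ->.
by rewrite /cconj rmorph0 oppr0.
Qed.

Lemma formal_Jadj U Y : l2 U -> l2 Y -> (forall k, Y k = jrow A B U k) ->
  Jadj A B U Y.
Proof.
move=> hU hY h; split=> //; split=> // M V sV.
apply/eqP; rewrite -subr_eq0 Jac_jrow /ipfin; apply/eqP.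
have := jacobi_green_formula U V M.
rewrite (sV M.+1) // (sV M) // !mulmx0 subrr => E.
by have -> : Y = jrow A B U by apply/funext => k; exact: h.
Qed.

End AdjointJacobi.

(** * Extension of a bounded kernel from finite sequences to l^2 *)

Section ResolventExtension.
Variables (R : realType) (N : nat) (A B : nat -> 'M[R[i]]_N).
Variables (Gam : nat -> nat -> 'M[R[i]]_N) (z : R[i]) (c : R).
Hypothesis c_ge0 : 0 <= c.
Hypothesis Gam_bounded : forall (V : nat -> 'cV[R[i]]_N) K M,
  \sum_(i < K) vnorm2 (\sum_(k < M) Gam i k *m V k) <= c * \sum_(k < M) vnorm2 (V k).
Hypothesis Gam_rec : forall k l,
  jrow A B (fun i => Gam i l) k = z *: Gam k l + (k == l)%:R%:M.
Implicit Types U V : nat -> 'cV[R[i]]_N.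

Definition trunc_apply U M i : 'cV[R[i]]_N := \sum_(k < M) Gam i k *m U k.

(* The extension of [Gam] from finite sequences to l^2, entry by entry. *)
Definition kernel_apply U i : 'cV[R[i]]_N := vlim (fun M => trunc_apply U M i).

Lemma trunc_apply_cvg U i : l2 U ->
  vcvg (fun M => trunc_apply U M i) (kernel_apply U i).
Proof.
move=> hU; apply: (@vlimP _ _ _ (series (fun k => vnorm2 (U k))) c) => // M M' MM'.
(* [V] is the piece of [U] between the two truncations; applying the kernel bound to it makes the
   truncated values Cauchy. *)
pose V k := if (k < M)%N then 0 else U k.
have -> : trunc_apply U M' i - trunc_apply U M i = \sum_(k < M') Gam i k *m V k.
  rewrite /trunc_apply (big_ord_widen _ (fun k => Gam i k *m U k) MM').
  rewrite [X in _ - X = _]big_mkcond -sumrB; apply: eq_bigr => k _; rewrite /V.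
  by case: ltnP; rewrite ?subrr ?mulmx0 ?subr0.
have -> : series (fun k => vnorm2 (U k)) M' - series (fun k => vnorm2 (U k)) M =
    \sum_(k < M') vnorm2 (V k).
  rewrite /series /= !big_mkord (big_ord_widen _ (fun k => vnorm2 (U k)) MM').
  rewrite [X in _ - X = _]big_mkcond -sumrB; apply: eq_bigr => k _; rewrite /V.
  case: ltnP; rewrite ?subrr ?subr0 // => _; rewrite /vnorm2 big1 // => j _.
  by rewrite mxE /= expr0n addr0.
(* Entry [i] is the last of the first [i + 1] entries, so their total bounds it. *)
apply: le_trans (Gam_bounded V i.+1 M').
rewrite (bigD1 ord_max) //= lerDl; apply: sumr_ge0 => j _; exact: vnorm2_ge0.
Qed.

Lemma trunc_apply_rec U M k :
  jrow A B (fun i => trunc_apply U M i) k =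
  z *: trunc_apply U M k + (if (k < M)%N then U k else 0).
Proof.
have E (f : nat -> nat -> 'cV[R[i]]_N) : jrow A B (fun i => \sum_(l < M) f l i) k =
    \sum_(l < M) jrow A B (f l) k.
  elim: M => [|M IH].
    by rewrite big_ord0 /jrow !big_ord0 !mulmx0; case: k => [|k];
      rewrite ?big_ord0 ?mulmx0 !addr0.
  rewrite big_ord_recr -IH /= -jrowD; congr jrow.
  by apply/funext => i; rewrite big_ord_recr.
rewrite (E (fun l i => Gam i l *m U l)).
under eq_bigr do rewrite jrowMr Gam_rec mulmxDl -scalemxAl mul_scalar_mx.
rewrite big_split -scaler_sumr; congr (_ + _).
case: ltnP => hk; last first.
  by apply: big1 => i _; rewrite gtn_eqF ?scale0r // (leq_trans (ltn_ord i)).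
rewrite (bigD1 (Ordinal hk)) //= eqxx scale1r big1 ?addr0 // => i hi.
have -> : (k == i :> nat) = false by apply/negbTE; rewrite eq_sym; exact: hi.
by rewrite scale0r.
Qed.

(** A row of [jrow] involves at most three entries, so the identity for truncations passes to the
    entrywise limit; the source is [U k] once the truncation exceeds [k]. *)
Lemma kernel_apply_rec U k : l2 U ->
  jrow A B (kernel_apply U) k = z *: kernel_apply U k + U k.
Proof.
move=> hU; have hT i := trunc_apply_cvg i hU.
apply: (@vcvg_unique _ _ (fun M => jrow A B (fun i => trunc_apply U M i) k)).
  rewrite /jrow; apply: vcvgD; first by apply: vcvgD; exact: vcvg_mulmx.
  case: k => [|k]; last exact: vcvg_mulmx.
  exact: (@vcvg_near_cst _ _ _ _ 0).
under eq_fun do rewrite trunc_apply_rec.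
apply: vcvgD; first exact: vcvgZ.
by apply: (@vcvg_near_cst _ _ _ _ k.+1) => M kM; rewrite kM.
Qed.

(** As in Fatou's lemma, the first [K] entries are fixed while the truncation grows; the resulting
    bound is uniform in [K]. *)
Lemma kernel_apply_l2 U : l2 U ->
  l2 (kernel_apply U) /\ l2norm2 (kernel_apply U) <= c * l2norm2 U.
Proof.
move=> hU; apply: l2_of_bounded => K.
have h : (fun M => \sum_(i < K) vnorm2 (trunc_apply U M i)) @ \oo -->
    \sum_(i < K) vnorm2 (kernel_apply U i).
  by apply: cvgn_sum => i; apply: vcvg_vnorm2; exact: trunc_apply_cvg.
rewrite -(cvg_lim _ h) //; apply: limr_le; first by apply/cvg_ex; eexists; exact: h.
exists 0%N => // M _ /=; apply: le_trans (Gam_bounded U K M) _.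
by rewrite ler_wpM2l //; exact: l2_partial_le.
Qed.

Lemma kernel_apply_linear a U V : l2 U -> l2 V ->
  kernel_apply (fun k => a *: U k + V k) =
  (fun k => a *: kernel_apply U k + kernel_apply V k).
Proof.
move=> hU hV; apply/funext => i.
have h := trunc_apply_cvg i (@l2_lincomb _ _ a U V hU hV); apply: (vcvg_unique h).
have -> : (fun M => trunc_apply (fun k => a *: U k + V k) M i) =
    (fun M => a *: trunc_apply U M i + trunc_apply V M i).
  apply/funext => M; rewrite /trunc_apply scaler_sumr -big_split.
  by apply: eq_bigr => k _; rewrite mulmxDr -scalemxAr.
by apply: vcvgD; [apply: vcvgZ|]; exact: trunc_apply_cvg.
Qed.

Lemma kernel_apply_findom M V : supp_below M V ->
  kernel_apply V = (fun i => \sum_(k < M) Gam i k *m V k).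
Proof.
move=> sV; apply/funext => i.
have hV : l2 V.
  apply: (proj1 (l2_of_bounded (c := \sum_(k < M) vnorm2 (V k)) _)) => K.
  have v0 : vnorm2 (0 : 'cV[R[i]]_N) = 0.
    by rewrite /vnorm2 big1 // => j _; rewrite mxE /= expr0n addr0.
  have [KM|/ltnW MK] := leqP K M.
    rewrite (big_ord_widen _ (fun k => vnorm2 (V k)) KM) big_mkcond.
    by apply: ler_sum => k _; case: ifP => // _; exact: vnorm2_ge0.
  rewrite (big_ord_widen _ (fun k => vnorm2 (V k)) MK) [leRHS]big_mkcond.
  by apply: ler_sum => k _; case: ltnP => // Mk; rewrite sV // v0.
apply: (vcvg_unique (trunc_apply_cvg i hV)).
apply: (@vcvg_near_cst _ _ _ _ M) => K MK.
rewrite /trunc_apply (big_ord_widen _ (fun k => Gam i k *m V k) MK) [RHS]big_mkcond.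
by apply: eq_bigr => k _; case: ltnP => // Mk; rewrite sV // mulmx0.
Qed.

End ResolventExtension.

(** * Absence of l^2 eigenvectors at [z] *)

Section Uniqueness.
Variables (R : realType) (n : nat) (P : nat -> {poly 'M[R[i]]_n.+1}).
Variables (A B : nat -> 'M[R[i]]_n.+1) (z : R[i]).
Hypothesis A_unit : forall k, A k \in unitmx.
Hypothesis P0_unit : mpeval (P 0%N) z \in unitmx.
Hypothesis P_rec : forall k,
  jrow A B (fun i => mpeval (P i) z) k = z *: mpeval (P k) z.
Hypothesis limit_point : forall v : 'cV[R[i]]_n.+1, v != 0 ->
  series (fun k => vnorm2 (mpeval (P k) z *m v)) @ \oo --> +oo.

Lemma l2_eigen_eq0 (D : nat -> 'cV[R[i]]_n.+1) : l2 D ->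
  (forall k, jrow A B D k = z *: D k) -> forall k, D k = 0.
Proof.
(* [v] is chosen so that P_0(z) v = D_0; the recurrence then forces equality at every index. *)
move=> hD eD; pose v := invmx (mpeval (P 0%N) z) *m D 0%N.
have DE k : D k = mpeval (P k) z *m v.
  apply/eqP; rewrite -subr_eq0 -mulmxN; apply/eqP.
  apply: (@jrow_eigen0 R n.+1 A B 1 (fun k => D k + mpeval (P k) z *m (- v)) z k) => //.
    by rewrite mulmxN mulKVmx // subrr.
  by move=> j _; rewrite jrowD jrowMr eD P_rec -scalemxAl scalerDr.
have [v0 k|v0] := eqVneq v 0; first by rewrite DE v0 mulmx0.
(* Divergence gives a partial sum of at least [l2norm2 D + 1], while every partial sum is at most
   [l2norm2 D]. *)
have := limit_point v0; move/cvgryPge => /(_ (l2norm2 D + 1)) [K _ hK].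
have := hK K (leqnn K); rewrite /= /series /= big_mkord.
under eq_bigr do rewrite -DE.
by move/le_trans => /(_ _ (l2_partial_le K hD)); rewrite gerDl ler10.
Qed.

End Uniqueness.

(** * Assembly of the resolvent statement *)

Unset Implicit Arguments.

Theorem theorem4p15 (R : realType) (n : nat)
  (tau : {measure set R -> \bar R}) (W : R -> 'M[R[i]]_n.+1)
  (P : nat -> {poly 'M[R[i]]_n.+1}) (A B : nat -> 'M[R[i]]_n.+1) :
  matrix_measure_data tau W ->
  (* orthonormal matrix polynomials *)
  (forall k, size (P k) = k.+1 /\ lead_coef (P k) \in unitmx) ->
  (forall k l, mint tau (fun x => mpeval (P k) (cre x) *m W x *m mxadj (mpeval (P l) (cre x)))
               = (k == l)%:R%:M) ->
  (* P_0 = M_0^{-1/2} *)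
  (exists X, posdef X /\ X *m X = invmx (M0 tau W) /\ P 0%N = X%:P) ->
  (* recurrence coefficients *)
  (forall k, A k \in unitmx /\ is_hermitian (B k)) ->
  (forall z, z *: mpeval (P 0%N) z = A 0%N *m mpeval (P 1%N) z + B 0%N *m mpeval (P 0%N) z) ->
  (forall k z, z *: mpeval (P k.+1) z =
     A k.+1 *m mpeval (P k.+2) z + B k.+1 *m mpeval (P k.+1) z + mxadj (A k) *m mpeval (P k) z) ->
  (* limit point case hypothesis *)
  (forall z : R[i], complex.Im z != 0 -> forall v : 'cV[R[i]]_n.+1, v != 0 ->
     series (fun k => vnorm2 (mpeval (P k) z *m v)) @ \oo --> +oo) ->
  forall z : R[i], complex.Im z != 0 ->
  exists G : (nat -> 'cV[R[i]]_n.+1) -> (nat -> 'cV[R[i]]_n.+1),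
    (* G is a bounded linear operator on l2 *)
    (forall U, l2 U -> l2 (G U)) /\
    (forall (a : R[i]) U V, l2 U -> l2 V -> G (fun k => a *: U k + V k) = (fun k => a *: G U k + G V k)) /\
    (exists c : R, forall U, l2 U -> l2norm2 (G U) <= c * l2norm2 U) /\
    (* G extends G_z defined on D *)
    (forall M V, supp_below M V -> G V = (fun i => \sum_(k < M) Gz tau W P z i k *m V k)) /\
    (* G = (J^* - z)^{-1}: z is in the resolvent set of J^* *)
    (forall U, l2 U -> Jadj A B (G U) (fun k => U k + z *: G U k)) /\
    (forall U Y, Jadj A B U Y -> G (fun k => Y k - z *: U k) = U).
Proof.
move=> [_ [hW [_ [mom _]]]] hP orth [X [_ [_ PX]]] hAB rec0 recS lp z hz.
have uA k : A k \in unitmx by have [] := hAB k.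
have hB k : is_hermitian (B k) by have [] := hAB k.
have P0E w : mpeval (P 0%N) w = X by rewrite /mpeval PX hornerC.
have Prec k w : jrow A B (fun i => mpeval (P i) w) k = w *: mpeval (P k) w.
  by case: k => [|k]; rewrite /jrow ?addr0 ?rec0 ?recS.
(* [P 0] is a constant polynomial, so its value is its leading coefficient. *)
have uX : mpeval (P 0%N) z \in unitmx.
  by have [_] := hP 0%N; rewrite P0E PX lead_coefC.
have c0 : 0 <= (complex.Im z ^+ 2)^-1 by rewrite invr_ge0 sqr_ge0.
have GamE : green tau W P z = Gz tau W P z.
  apply/funext => i; apply/funext => k; symmetry.
  apply: (@Gz_green _ _ _ _ _ A B) => // w w'; by rewrite !P0E.
have bnd := fun V K M => green_bounded mom hW orth V K M hz.
have grec := fun k l => green_rec mom orth Prec k l hz.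
pose G := kernel_apply (green tau W P z).
have G_Jadj U : l2 U -> Jadj A B (G U) (fun k => U k + z *: G U k).
  move=> hU; have [hG _] := kernel_apply_l2 c0 bnd hU.
  apply: formal_Jadj => //.
    have := @l2_lincomb _ _ z _ _ hG hU.
    by congr l2; apply/funext => k; rewrite addrC.
  by move=> k; rewrite (kernel_apply_rec bnd grec) // addrC.
exists G; split; [|split; [|split; [|split; [|split]]]].
- by move=> U /(kernel_apply_l2 c0 bnd) [].
- by move=> a U V; exact: (kernel_apply_linear bnd).
- by exists (complex.Im z ^+ 2)^-1 => U /(kernel_apply_l2 c0 bnd) [].
- by move=> M V sV; rewrite /G (kernel_apply_findom bnd sV) GamE.
- exact: G_Jadj.
move=> U Y hUY; have [hU [hY _]] := hUY.
have YE := Jadj_formal hB hUY.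
have hV : l2 (fun k => Y k - z *: U k).
  have := @l2_lincomb _ _ (- z) _ _ hU hY.
  by congr l2; apply/funext => k; rewrite scaleNr addrC.
have [hG _] := kernel_apply_l2 c0 bnd hV.
(* The sequence G(Y - zU) - U is in l^2, and both of its terms satisfy the recurrence with source Y
   - zU up to sign; the sources cancel, so it is a formal eigenvector and vanishes. *)
have hD : l2 (fun k => -1 *: U k + G (fun k => Y k - z *: U k) k).
  exact: l2_lincomb.
apply/funext => k; apply/eqP; rewrite -subr_eq0 addrC -scaleN1r; apply/eqP.
apply: (l2_eigen_eq0 uA uX (fun k => Prec k z) (lp z hz) hD) => {}k.
rewrite jrowD jrowZ (kernel_apply_rec bnd grec) // -YE !scaleN1r scalerDr scalerN.
by rewrite [z *: _ + _]addrC addrA addrA addNr add0r addrC.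
Qed.
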